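(* Let $k$ be a field of characteristic zero, let $s,t\geq 1$ and $u\geq 0$ be integers, and let $c_1,c_2\in k\setminus\{0\}$. Let $d$ denote the $k$-derivation $\partial_x + x^u(c_1x^ty^s+c_2)\partial_y$ of the polynomial ring $k[x,y]$. Then $d$ is a simple derivation of $k[x,y]$.
   Context: A derivation $d$ of a commutative ring $A$ with unity is a map $d:A\to A$ with $d(a+b)=d(a)+d(b)$ and $d(ab)=a\,d(b)+b\,d(a)$ for all $a,b\in A$; if $A$ is a $k$-algebra, a $k$-derivation is a derivation that is also $k$-linear. An ideal $I$ of $A$ is $d$-differential if $d(I)\subseteq I$. The derivation $d$ is called simple if $\{0\}$ and $A$ are the only $d$-differential ideals of $A$. For $P,Q\in k[x,y]$, $P\partial_x+Q\partial_y$ denotes the unique $k$-derivation of $k[x,y]$ sending $x\mapsto P$ and $y\mapsto Q$. *)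

(* Defs.v *)
From HB Require Import structures.
From mathcomp Require Import all_boot all_order all_algebra.
From mathcomp Require Import mpoly.

Set Implicit Arguments.
Unset Strict Implicit.
Unset Printing Implicit Defensive.

Import GRing.Theory.
Local Open Scope ring_scope.

Definition derivation (A : comPzRingType) (d : A -> A) : Prop :=
  (forall a b : A, d (a + b) = d a + d b) /\
  (forall a b : A, d (a * b) = a * d b + b * d a).

Definition kderivation (k : comNzRingType) (A : comAlgType k) (d : A -> A) :
    Prop :=
  derivation d /\ (forall (c : k) (a : A), d (c *: a) = c *: d a).

(* Prop-valued, unlike the library's boolean [idealr] predicates, so that
   all ideals are covered and not only those with decidable membership. *)
Definition ideal (A : comPzRingType) (I : A -> Prop) : Prop :=
  [/\ I 0,
      forall a b : A, I a -> I b -> I (a + b)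
    & forall a b : A, I b -> I (a * b)].

Definition differential_ideal (A : comPzRingType) (d : A -> A)
    (I : A -> Prop) : Prop :=
  ideal I /\ (forall a : A, I a -> I (d a)).

Definition simple_derivation (A : comPzRingType) (d : A -> A) : Prop :=
  derivation d /\
  (forall I : A -> Prop, differential_ideal d I ->
     (forall a : A, I a <-> a = 0) \/ (forall a : A, I a)).

Section PolynomialsInTwoVariables.

Variable k : fieldType.

(* k[x,y] is {mpoly k[2]}, with x the variable of index 0 and y that of
   index 1. *)
Definition xvar : {mpoly k[2]} := 'X_(ord0 : 'I_2).
Definition yvar : {mpoly k[2]} := 'X_(ord_max : 'I_2).

(* P d/dx + Q d/dy; [derxy_kderivation], [derxy_x], [derxy_y] and
   [derxy_unique] show that it is the unique k-derivation sending x to P and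
   y to Q. *)
Definition derxy (P Q : {mpoly k[2]}) (p : {mpoly k[2]}) : {mpoly k[2]} :=
  P * mderiv (ord0 : 'I_2) p + Q * mderiv (ord_max : 'I_2) p.

Lemma derxy_kderivation (P Q : {mpoly k[2]}) : kderivation (derxy P Q).
Proof.
split; first split.
- by move=> a b; rewrite /derxy !mderivD !mulrDr addrACA.
- move=> a b; rewrite /derxy !mderivM !mulrDr.
  rewrite addrACA addrC; congr (_ + _); congr (_ + _);
  by rewrite ?(mulrC _ b) mulrCA.
- by move=> c a; rewrite /derxy !mderivZ -!scalerAr scalerDr.
Qed.

Lemma derxy_x (P Q : {mpoly k[2]}) : derxy P Q xvar = P.
Proof.
rewrite /derxy /xvar !mderivX !mnm1E eqxx /= scale1r scale0r mulr0 addr0.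
by rewrite -[X in (X - _)%MM]addm0 addmC addmK mpolyX0 mulr1.
Qed.

Lemma derxy_y (P Q : {mpoly k[2]}) : derxy P Q yvar = Q.
Proof.
rewrite /derxy /yvar !mderivX !mnm1E eqxx /= scale1r scale0r mulr0 add0r.
by rewrite -[X in (X - _)%MM]addm0 addmC addmK mpolyX0 mulr1.
Qed.

Lemma derxy_unique (P Q : {mpoly k[2]}) (d : {mpoly k[2]} -> {mpoly k[2]}) :
  kderivation d -> d xvar = P -> d yvar = Q -> d =1 derxy P Q.
Proof.
move=> [[dD dM] dZ] dx dy.
have [[eD eM] eZ] := derxy_kderivation P Q.
have der1 (e : {mpoly k[2]} -> {mpoly k[2]}) :
    (forall a b, e (a * b) = a * e b + b * e a) -> e 1 = 0.
  move=> He; have := He 1 1; rewrite !mul1r => /eqP.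
  by rewrite -subr_eq0 opprD addrA subrr sub0r oppr_eq0 => /eqP.
have eqM a b : d a = derxy P Q a -> d b = derxy P Q b ->
    d (a * b) = derxy P Q (a * b) by move=> ha hb; rewrite dM eM ha hb.
have eq1 : d 1 = derxy P Q 1 by rewrite (der1 _ dM) (der1 _ eM).
have eqV i : d 'X_i = derxy P Q 'X_i.
  have [->|->] : i = ord0 \/ i = ord_max.
    by case: i => [[|[|//]] Hi]; [left|right]; apply: val_inj.
  - by rewrite [LHS]dx [RHS]derxy_x.
  - by rewrite [LHS]dy [RHS]derxy_y.
elim/mpolyind => [|c m p _ _ IHp].
  by rewrite -(scale0r 1) dZ eZ !scale0r.
rewrite dD eD dZ eZ IHp; congr (_ *: _ + _).
rewrite mpolyXE_id; apply: (big_ind (fun p => d p = derxy P Q p)) => // i _.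
by elim: (m i) => [|n IHn]; rewrite ?expr0 // exprS; apply: eqM.
Qed.

End PolynomialsInTwoVariables.

(* Main.v *)
From HB Require Import structures.
Require Import Defs.
From mathcomp Require Import all_boot all_order all_algebra.
From mathcomp Require Import mpoly ring zify.
From Stdlib Require Import Classical_Prop.
Set Implicit Arguments.
Unset Strict Implicit.
Unset Printing Implicit Defensive.
Import GRing.Theory.
Local Open Scope ring_scope.

(** Write d = d/dx + F d/dy with F = x^u (c1 x^t y^s + c2).

    If I is a nonzero d-invariant ideal, take g of least degree n in y, and then
    with leading coefficient of least degree in x, among the polynomials that
    have a nonzero k[x]-multiple in I.  If n = 0, then I contains a nonzero
    polynomial in x, and differentiating it down to a constant gives 1 in I.
    If n > 0, then g is primitive, pseudo-division of d g by g leaves no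
    remainder, and the Gauss lemma gives d g = L g with L in k[x,y]
    ([invariant_ideal_darboux]).  So it is enough to show that no polynomial of
    positive degree in y divides its image under d ([no_darboux_polynomial]).

    This is a computation at x = infinity.  There every branch of the curve
    g = 0 has y ~ rho x^(-t/s) with f(rho) = 0, where f = c1 Y^s + c2.  So give
    x the weight s and y the weight -t: substitute x = z^s, y = z^(-t) Y, clear
    denominators by a power z^E, and call H the polynomial in z and Y obtained
    from g ([rescale]).  The equation d g = L g becomes
      z^e (z H_z - E H + t Y H_Y + s z^G f H_Y) = s K H
    where G = s(u+1) + t, e = t(s-1), and K comes from x L
    ([graded_equation]).

    Let M be the degree of H in z, h_m the coefficient of z^(M-m) in H and l_m
    that of z^(e+G-m) in K.  For m = 0 we get f h_0' = l_0 h_0.  For 0 < m < G,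
    by induction, f h_m' = l_0 h_m + l_m h_0, that is f (h_m/h_0)' = l_m; a
    derivative has no simple poles and f is squarefree, so h_m/h_0 is constant
    and l_m = 0 ([squarefree_wronskian_eq0]).  For m = G the terms z H_z - E H
    and t Y H_Y enter:
      (M - E) h_0 + t Y h_0' + s f h_G' = s (l_0 h_G + l_G h_0).
    As L is a polynomial in x, no term x^(-1) occurs in it, whence l_G(0) = 0.
    Removing the poles of h_G/h_0 and evaluating at Y = 0 then gives
    s (M - E) + n t = 0 ([subleading_relation]).  But h_0(0) is not 0
    ([darboux_coef0_neq0]), so that z^M Y^0 comes from a monomial x^i of g and
    M >= E: a contradiction, since n t > 0. *)

(** * Preliminaries *)

(** Closes an equation that is c times a known equation modulo [ring]; applied
    repeatedly, it certifies a linear combination of known equations. *)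
Lemma eq_of_multiple (R : comPzRingType) (c l r a b : R) :
  l = r -> a - b = c * (l - r) -> a = b.
Proof. by move=> ->; rewrite subrr mulr0 => /eqP; rewrite subr_eq0 => /eqP. Qed.

Lemma coefM_top (R : nzRingType) (p q : {poly R}) P Q :
    (size p <= P.+1)%N -> (size q <= Q.+1)%N ->
  (p * q)`_(P + Q) = p`_P * q`_Q.
Proof.
move=> sp sq; rewrite coefM.
have lt_P : (P < (P + Q).+1)%N by rewrite ltnS leq_addr.
rewrite (bigD1 (Ordinal lt_P)) //= addKn big1 ?addr0 // => -[i /= lt_i] ne_iP.
have {}ne_iP : i != P by apply: contraNneq ne_iP => iP; apply/eqP/val_inj.
have [lt_Pi|le_iP] := ltnP P i; first by
  rewrite nth_default ?mul0r // (leq_trans sp).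
by rewrite [q`__]nth_default ?mulr0 // (leq_trans sq) //; lia.
Qed.

Lemma coefM_top2 (R : nzRingType) (p q : {poly R}) P Q m :
    (size p <= P.+1)%N -> (size q <= Q.+1)%N ->
    (0 < m)%N -> (m <= P)%N -> (m <= Q)%N ->
    (forall i, (0 < i < m)%N -> p`_(P - i) = 0) ->
  (p * q)`_(P + (Q - m)) = p`_P * q`_(Q - m) + p`_(P - m) * q`_Q.
Proof.
move=> sp sq m_gt0 le_mP le_mQ p0; rewrite coefM.
have lt_P : (P < (P + (Q - m)).+1)%N by rewrite ltnS leq_addr.
have lt_Pm : (P - m < (P + (Q - m)).+1)%N by lia.
rewrite (bigD1 (Ordinal lt_P)) //= addKn; congr (_ + _).
rewrite (bigD1 (Ordinal lt_Pm)) /=; last by rewrite -val_eqE /=; lia.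
have -> : (P + (Q - m) - (P - m) = Q)%N by lia.
rewrite big1 ?addr0 // => -[i /= lt_i]; rewrite -!val_eqE /=.
move=> /andP[ne_P ne_Pm].
have [lt_Pi|le_iP] := ltnP P i; first by
  rewrite nth_default ?mul0r // (leq_trans sp).
have [lt_im|le_mi] := ltnP i (P - m).
  by rewrite [q`__]nth_default ?mulr0 // (leq_trans sq) //; lia.
by rewrite -(subKn le_iP) p0 ?mul0r //; lia.
Qed.

Lemma ex_least (P : nat -> Prop) : (exists n, P n) ->
  exists2 n, P n & forall m, P m -> (n <= m)%N.
Proof.
move=> [n Pn]; apply: NNPP => no_least.
have: forall m, ~ P m; last by move/(_ n).
elim/ltn_ind=> m IHm Pm; apply: no_least; exists m => // i Pi.
by rewrite leqNgt; apply/negP=> /IHm.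
Qed.

(** * Univariate polynomials in characteristic zero *)

Section Univariate.
Variable k : fieldType.
Hypothesis char0 : [pchar k] =i pred0.

Lemma natr_neq0 n : (0 < n)%N -> n%:R != 0 :> k.
Proof. by move=> n_gt0; move/pcharf0P: char0 => ->; rewrite -lt0n. Qed.

Lemma natr_inj m n : m%:R = n%:R :> k -> m = n.
Proof.
wlog le_mn : m n / (m <= n)%N => [IH E|/esym/eqP].
  by case/orP: (leq_total m n) => /IH->.
rewrite -subr_eq0 -natrB // => nm0; apply/eqP; rewrite eqn_leq le_mn /=.
by rewrite -subn_eq0 -leqn0 leqNgt; apply: contraTN nm0 => /natr_neq0.
Qed.

Lemma mulrn_inj (V : lmodType k) n :
  (0 < n)%N -> injective (fun v : V => v *+ n).
Proof.
by move=> n_gt0 v w; rewrite /= -!scaler_nat => /(scalerI (natr_neq0 n_gt0)).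
Qed.

Lemma size_deriv0 (p : {poly k}) : p^`() = 0 -> (size p <= 1)%N.
Proof.
move=> p'0; apply/leq_sizeP=> -[//|j] _; apply/eqP.
have /eqP := coef_deriv p j; rewrite p'0 coef0 eq_sym -mulr_natr mulf_eq0.
by rewrite (negPf (natr_neq0 (ltn0Sn j))) orbF.
Qed.

(** The hypothesis says f (h/h0)' = mu.  At a pole of h/h0 the derivative has a
    pole of order at least 2, which the squarefree f cannot cancel; so h/h0 is a
    polynomial, constant because of the degrees.  To avoid passing to the roots,
    the radical B1 = B / gcd(B, B') of the reduced denominator B is shown to
    divide f twice. *)
Lemma squarefree_wronskian_eq0 (f h0 h mu : {poly k}) :
    coprimep f f^`() -> h0 != 0 -> (size h <= size h0)%N ->
    f * (h^`() * h0 - h * h0^`()) = mu * h0 ^+ 2 ->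
  mu = 0.
Proof.
move=> cof h0_neq0 le_h.
pose p := gcdp h h0; pose A := h %/ p; pose B := h0 %/ p.
have hE : h = A * p by rewrite divpK ?dvdp_gcdl.
have h0E : h0 = B * p by rewrite divpK ?dvdp_gcdr.
have [B0 p0] : B != 0 /\ p != 0.
  by move: h0_neq0; rewrite h0E mulf_eq0 negb_or => /andP.
have coAB : coprimep A B by apply: coprimep_div_gcd; rewrite h0_neq0 orbT.
have le_AB : (size A <= size B)%N.
  have [->|A0] := eqVneq A 0; first by rewrite size_poly0.
  move: le_h; rewrite hE h0E !size_mul //; have := size_poly_gt0 p.
  by rewrite p0; case: (size p) => // m _; rewrite !addnS leq_add2r.
rewrite hE h0E => eqAB.
have {}eqAB : f * (A^`() * B - A * B^`()) = mu * B ^+ 2.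
  apply: (mulIf (expf_neq0 2 p0)); rewrite !derivM in eqAB.
  by apply: (eq_of_multiple (c := 1) eqAB); ring.
pose D := gcdp B B^`(); pose B1 := B %/ D; pose B2 := B^`() %/ D.
have BE : B = B1 * D by rewrite divpK ?dvdp_gcdl.
have B'E : B^`() = B2 * D by rewrite divpK ?dvdp_gcdr.
have [B10 D0] : B1 != 0 /\ D != 0.
  by move: B0; rewrite {1}BE mulf_eq0 negb_or => /andP.
have coB12 : coprimep B1 B2 by apply: coprimep_div_gcd; rewrite B0.
have coB1A : coprimep B1 A.
  by rewrite coprimep_sym; apply: coprimep_dvdl coAB; rewrite BE dvdp_mulr.
have eqB1 : f * (A^`() * B1 - A * B2) = mu * B1 ^+ 2 * D.
  apply: (mulIf (mulf_neq0 D0 D0)); move: eqAB.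
  by rewrite B'E BE => E; apply: (eq_of_multiple (c := D) E); ring.
(* B1 is coprime to A and to B2, hence to the second factor on the left. *)
have dvd_step e m : e * (A^`() * B1 - A * B2) = m * B1 -> B1 %| e.
  move=> eqe; rewrite -(Gauss_dvdpl _ coB1A) -(Gauss_dvdpl _ coB12).
  have -> : e * A * B2 = (e * A^`() - m) * B1.
    by apply: (eq_of_multiple (c := -1) eqe); ring.
  exact: dvdp_mull.
have /dvdpP [f1 fE] : B1 %| f.
  by apply: (dvd_step f (mu * B1 * D)); rewrite eqB1; ring.
have /dvdpP [f2 f1E] : B1 %| f1.
  apply: (dvd_step f1 (mu * D)); apply: (mulIf B10).
  by rewrite fE in eqB1; apply: (eq_of_multiple (c := 1) eqB1); ring.
have sB1 : size B1 = 1%N.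
  apply/eqP; rewrite -dvdp1; have := cof; rewrite /coprimep -dvdp1.
  apply: dvdp_trans; rewrite dvdp_gcd fE f1E dvdp_mull //=.
  have -> : (f2 * B1 * B1)^`() = (f2^`() * B1 + f2 * B1^`() *+ 2) * B1.
    by rewrite !derivM; ring.
  exact: dvdp_mull.
(* As B1 is a unit, B divides B', which has smaller degree. *)
have B'0 : B^`() = 0.
  have dvBB' : B %| B^`().
    apply: dvdp_trans (dvdp_gcdr B B^`()); rewrite {1}BE.
    by rewrite -[X in _ %| X]mul1r dvdp_mul // dvdp1 sB1.
  apply: contraTeq dvBB' => B'_neq0; apply/negP=> /(dvdp_leq B'_neq0).
  by rewrite leqNgt lt_size_deriv.
have A'0 : A^`() = 0.
  have /size1_polyC -> := leq_trans le_AB (size_deriv0 B'0).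
  exact: derivC.
move: eqAB; rewrite A'0 B'0 mul0r mulr0 subr0 mulr0 => /esym/eqP.
by rewrite mulf_eq0 expf_eq0 (negPf B0) orbF => /eqP.
Qed.

(** * The derivation d/dx + F d/dy of k[x][y] *)

(** Here k[x][y] is [{poly {poly k}}]: the outer variable is y, the inner one
    is x. *)
Definition xder (F g : {poly {poly k}}) : {poly {poly k}} :=
  map_poly (@deriv k) g + F * g^`().

Lemma xderZ F (p : {poly k}) g : xder F (p *: g) = p^`() *: g + p *: xder F g.
Proof.
apply/polyP=> i; rewrite /xder derivZ -scalerAr.
rewrite !(coefD, coefZ, coef_map) /= derivM; ring.
Qed.

Lemma xderC F (p : {poly k}) : xder F p%:P = p^`()%:P.
Proof. by rewrite /xder derivC mulr0 addr0 map_polyC. Qed.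

Lemma swapXY_map_deriv (p : {poly {poly k}}) :
  swapXY (map_poly (@deriv k) p) = (swapXY p)^`().
Proof.
by apply/polyP=> i; apply/polyP=> j;
  rewrite coef_swapXY coef_map coef_deriv coef_deriv coefMn coef_swapXY.
Qed.

Lemma swapXY_deriv (p : {poly {poly k}}) :
  swapXY p^`() = map_poly (@deriv k) (swapXY p).
Proof. by rewrite -[p in LHS]swapXYK -swapXY_map_deriv swapXYK. Qed.

(** * Homogeneous parts along the binomial c1 Y^s + c2 *)

Section Binomial.
Variables (s t : nat) (c1 c2 : k).
Hypotheses (s_gt0 : (0 < s)%N) (c1_neq0 : c1 != 0) (c2_neq0 : c2 != 0).

Definition binom : {poly k} := c1 *: 'X^s + c2%:P.

Lemma mulX_deriv_binom : 'X * binom^`() = (binom - c2%:P) *+ s.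
Proof.
rewrite /binom derivD derivZ derivXn derivC addr0 addrK -scalerAr mulrnAr.
by rewrite -exprS prednK // scalerMnr.
Qed.

Lemma coprime_binom_deriv : coprimep binom binom^`().
Proof.
have sc2 : c2 *+ s != 0 by rewrite -mulr_natr mulf_neq0 ?natr_neq0.
rewrite /coprimep -dvdp1; set d := gcdp _ _.
suff : d %| (c2 *+ s)%:P by rewrite -[X in X%:P]mulr1 polyCM mul_polyC dvdpZr.
have -> : (c2 *+ s)%:P = binom *+ s - 'X * binom^`().
  by rewrite mulX_deriv_binom mulrnBl subKr polyCMn.
by rewrite dvdp_sub ?dvdp_mull ?dvdp_gcdr // -mulr_natr dvdp_mulr ?dvdp_gcdl.
Qed.

Lemma binom_coef0 : binom`_0 = c2.
Proof.
by rewrite coefD coefZ coefXn coefC eqxx eq_sym -leqn0 leqNgt s_gt0 mulr0 add0r.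
Qed.

(** If 0 were a root of h of multiplicity e > 0, it would be a root of h' of
    multiplicity e - 1, whereas the binomial takes the nonzero value c2 at 0. *)
Lemma darboux_coef0_neq0 (h l : {poly k}) :
  h != 0 -> binom * h^`() = l * h -> h`_0 != 0.
Proof.
move=> h_neq0 eqh; apply/negP=> h00.
have [e [q q0 hE]] := multiplicity_XsubC h 0.
move: q0 hE; rewrite h_neq0 /= subr0 => q0 hE.
case: e hE => [|e] hE.
  by move: q0 h00; rewrite hE expr0 mulr1 rootE horner_coef0 => /negP.
have : root (binom * q *+ e.+1) 0.
  have -> : binom * q *+ e.+1 = (l * q - binom * q^`()) * 'X.
    apply: (mulIf (expf_neq0 e (negbT (polyX_eq0 k)))).
    move: eqh; rewrite hE derivM derivXn /= exprS => eqh.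
    by apply: (eq_of_multiple (c := 1) eqh); ring.
  by rewrite rootM rootX eqxx orbT.
rewrite -mulr_natr -polyC_natr rootM rootC (negPf (natr_neq0 _)) // orbF.
rewrite rootM (negPf q0) orbF rootE horner_coef0 binom_coef0.
by rewrite (negPf c2_neq0).
Qed.

(** Write f for the binomial and W = h/h0.  The equation makes
    s f W' + t X h0'/h0 a polynomial, which determines the poles of W: they are
    simple, with residue t rho m / (s f'(rho)) = - t rho^2 m / (s^2 c2) at a
    root rho of h0 of multiplicity m, because f(rho) = 0 gives
    rho f'(rho) = - s c2.  The sum of the fractions m rho^2 / (X - rho) is
    e / h0 up to a constant, for the polynomial e = X^2 h0' - n X h0 of the
    proof.  Hence s^2 c2 h + t e is free of these poles and the previous lemma
    on Wronskians applies to it; the relation is the vanishing of the constant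
    term of the resulting mu. *)
Lemma subleading_relation (h0 h l0 l : {poly k}) (nu : k) :
    h0 != 0 -> (size h <= size h0)%N -> binom * h0^`() = l0 * h0 ->
    nu *: h0 + ('X * h0^`()) *+ t + (binom * h^`()) *+ s =
      (l0 * h + l * h0) *+ s ->
    l`_0 = 0 ->
  nu *+ s + ((size h0).-1 * t)%:R = 0.
Proof.
move=> h0_neq0 le_h eq0 eqG l00; set n := (size h0).-1.
pose e := 'X ^+ 2 * h0^`() - ('X * h0) *+ n.
pose hs := (c2 *: h) *+ s ^ 2 + e *+ t.
pose mu := (c2 *: l) *+ s ^ 2 - (c2 * nu *+ s)%:P
  + ('X ^+ 2 * l0^`() + ('X * l0) *+ 2 - ('X * l0) *+ s - binom *+ n) *+ t.
have szh0 : size h0 = n.+1 by rewrite prednK // size_poly_gt0.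
have le_hs : (size hs <= size h0)%N.
  have le_e : (size e <= size h0)%N.
    (* The coefficients of X^(n+1) in the two terms of e cancel. *)
    rewrite szh0; apply/leq_sizeP=> j lt_j.
    rewrite coefB coefMn coefXM coefXnM coef_deriv.
    case: j lt_j => [//|[|j]] lt_j /=.
      by rewrite /= sub0r; case: (n) lt_j => // _; rewrite mulr0n oppr0.
    have [->|ne_jn] := eqVneq n j.+1; first by rewrite subSS subn1 subrr.
    rewrite subSS subn1 /= nth_default ?mul0rn ?subr0 ?szh0 //.
    by rewrite ltn_neqAle ne_jn.
  rewrite /hs -!scaler_nat (leq_trans (size_polyD _ _)) // geq_max.
  by rewrite !(leq_trans (size_scale_leq _ _)).
have eq0' : binom * h0^`()^`() = l0^`() * h0 + l0 * h0^`() - binom^`() * h0^`().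
  by move: (congr1 (fun p => p^`()) eq0); rewrite !derivM => E;
    apply: (eq_of_multiple (c := 1) E); ring.
have mu0 : mu = 0.
  apply: (squarefree_wronskian_eq0 coprime_binom_deriv h0_neq0 le_hs).
  have XE := mulX_deriv_binom.
  have E : binom * hs^`() = l0 * hs + mu * h0.
    rewrite /hs /e /mu.
    rewrite !(derivD, derivB, derivN, derivMn, derivM, derivX, derivXn,
      derivZ) /= expr1.
    rewrite -!mul_polyC in eqG *; rewrite -?mul_polyC polyCMn polyCM.
    apply: (eq_of_multiple (c := c2%:P *+ s) eqG).
    apply: (eq_of_multiple (c := 'X ^+ 2 *+ t) eq0').
    apply: (eq_of_multiple (c := - ('X * h0^`() *+ t)) XE).
    apply: (eq_of_multiple (c := ('X *+ 2 - 'X *+ n - 'X *+ s) *+ t) eq0).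
    ring.
  rewrite expr2 mulrBr !mulrA E [binom * _]mulrC -(mulrA hs) eq0; ring.
have /eqP := congr1 (fun p : {poly k} => p`_0) mu0.
rewrite /mu !(coefD, coefB, coefN, coefMn, coefZ, coefC, coefXM, coefXnM) /=.
have := binom_coef0; rewrite coefD coefZ coefC /= => ->.
rewrite l00 => /eqP E; apply: (mulfI c2_neq0).
apply: (eq_of_multiple (c := -1) E); ring.
Qed.

Lemma coef_binom_deriv (p : {poly k}) N : (size p <= N.+1)%N ->
  (binom * p^`())`_(N + s.-1) = c1 * p`_N *+ N.
Proof.
move=> sp; rewrite mulrDl coefD -scalerAl mul_polyC !coefZ coefXnM !coef_deriv.
have -> : p`_(N + s.-1).+1 = 0.
  by rewrite nth_default // (leq_trans sp) // ltnS leq_addr.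
rewrite mul0rn mulr0 addr0; case: N sp => [|N] _.
  by rewrite add0n prednK // leqnn mulr0.
by rewrite addSn -addnS prednK // ltnNge leq_addl addnK -mulrnAr.
Qed.

(** * Weighted rescaling *)

(** The polynomial z^E g(z^s, z^(-t) Y), with outer variable Y and inner
    variable z.  The truncated subtraction makes this true only when E >= t j
    for every power y^j that occurs in g. *)
Definition rescale E (g : {poly {poly k}}) : {poly {poly k}} :=
  \poly_(j < size g) ((g`_j \Po 'X^s) * 'X^(E - t * j)).

Lemma coef_rescale E g j : (rescale E g)`_j = (g`_j \Po 'X^s) * 'X^(E - t * j).
Proof.
rewrite coef_poly; case: ltnP => // /leq_sizeP/(_ j (leqnn j)) ->.
by rewrite comp_poly0 mul0r.
Qed.

Lemma rescaleD E g1 g2 : rescale E (g1 + g2) = rescale E g1 + rescale E g2.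
Proof.
by apply/polyP=> j; rewrite coefD !coef_rescale coefD comp_polyD mulrDl.
Qed.

Lemma rescaleM E1 E2 (g1 g2 : {poly {poly k}}) :
    (forall j, g1`_j != 0 -> (t * j <= E1)%N) ->
    (forall j, g2`_j != 0 -> (t * j <= E2)%N) ->
  rescale (E1 + E2) (g1 * g2) = rescale E1 g1 * rescale E2 g2.
Proof.
move=> le1 le2; apply/polyP=> j.
rewrite coef_rescale !coefM rmorph_sum mulr_suml.
apply: eq_bigr => -[i /= le_ij] _; rewrite !coef_rescale rmorphM /=.
have [->|/le1 lei] := eqVneq g1`_i 0; first by rewrite comp_poly0 !mul0r.
have [->|/le2 lej] := eqVneq g2`_(j - i) 0.
  by rewrite comp_poly0 !(mul0r, mulr0).
rewrite mulrACA -exprD; congr (_ * 'X^_).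
rewrite ltnS in le_ij; move: lej; rewrite mulnBr => lej.
have := leq_mul (leqnn t) le_ij; lia.
Qed.

Variable u : nat.

(** The difference of the weights of F d/dy and d/dx, for the weights s of x and
    -t of y. *)
Definition gap := (s * u.+1 + t)%N.

Definition field_coef : {poly {poly k}} :=
  ('X^u)%:P * ((c1 *: 'X^t)%:P * 'X^s + c2%:P%:P).

(** Since x d/dx is s^(-1) (z d/dz + t Y d/dY) in the variables z and Y, the
    factor z^E accounts for the term in E.  The factor z^(t (s-1)) and the
    exponent on the left leave room for the y-degree of F d/dy. *)
Lemma rescale_euler E (g : {poly {poly k}}) :
    (forall j, g`_j != 0 -> (t * j <= E)%N) ->
  rescale (E + t * s.-1) ('X *: map_poly (@deriv k) g) *+ s =
    ('X^(t * s.-1))%:P * ('X%:P * map_poly (@deriv k) (rescale E g)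
      - rescale E g *+ E + ('X * (rescale E g)^`()) *+ t).
Proof.
move=> leE; apply/polyP=> j.
rewrite coefMn coef_rescale coefZ coef_map coefCM coefD coefB coefCM !coefMn.
rewrite coefXM.
have -> : (if j == 0 then 0 else (rescale E g)^`()`_j.-1)
    = (rescale E g)`_j *+ j.
  by case: j => [|j]; rewrite ?mulr0n // coef_deriv.
rewrite coef_map coef_rescale /=.
have [->|/leE le_j] := eqVneq g`_j 0.
  by rewrite linear0 !(mulr0, comp_poly0, mul0r, mul0rn, linear0, subr0, addr0).
set a := g`_j; have [e ->] : exists e, E = (e + t * j)%N.
  by exists (E - t * j)%N; rewrite subnK.
rewrite addnAC !addnK.
rewrite exprD derivM deriv_comp !derivXn comp_polyM comp_polyX.
have Xs : 'X * 'X^(s.-1) = 'X^s :> {poly k} by rewrite -exprS prednK.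
have Xe : 'X * 'X^(e.-1) *+ e = 'X^e *+ e :> {poly k}.
  by case: (e) => [|e'] //=; rewrite -exprS.
set b := 'X^(t * s.-1).
apply: (eq_of_multiple (c := - (b * (a^`() \Po 'X^s) * 'X^e *+ s)) Xs).
apply: (eq_of_multiple (c := - (b * (a \Po 'X^s))) Xe).
ring.
Qed.

Lemma rescale_field_coef : rescale (t * s) ('X *: field_coef) =
  ('X^(s * u.+1 + t * s))%:P * map_poly polyC binom.
Proof.
apply/polyP=> j; rewrite coef_rescale coefZ /field_coef !coefCM coef_map.
rewrite !(coefD, coefCM, coefXn, coefC) coefZ coefXn /=.
rewrite !comp_polyM comp_polyX comp_Xn_poly -exprM mulrA -exprD.
have -> : (s + s * u = s * u.+1)%N by rewrite mulnS.
have [->|_] := eqVneq j s.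
  rewrite (gtn_eqF s_gt0) subnn expr0 !mulr1n !mulr1 !addr0.
  rewrite comp_polyZ comp_Xn_poly -exprM.
  by rewrite -mul_polyC exprD -mulrA [c1%:P * _]mulrC (mulnC t).
rewrite !mulr0n !mulr0 !add0r; case: eqP => [->|_]; last first.
  by rewrite comp_poly0 !(mulr0, mul0r).
by rewrite comp_polyC muln0 subn0 exprD mulrAC.
Qed.

Lemma rescale_xder E (g : {poly {poly k}}) : (t <= E)%N ->
    (forall j, g`_j != 0 -> (t * j <= E)%N) ->
  rescale (E + t * s.-1) ('X *: xder field_coef g) *+ s =
    ('X^(t * s.-1))%:P * (
      'X%:P * map_poly (@deriv k) (rescale E g) - rescale E g *+ E
      + ('X * (rescale E g)^`()) *+ t
      + ('X^gap)%:P * (map_poly polyC binom * (rescale E g)^`()) *+ s).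
Proof.
move=> le_tE leE; rewrite /xder scalerDr rescaleD mulrnDl rescale_euler //.
rewrite [RHS]mulrDr; congr (_ + _); rewrite scalerAl.
have -> : (E + t * s.-1 = t * s + (E - t))%N.
  by rewrite -{2}(prednK s_gt0) mulnS; lia.
rewrite rescaleM.
- have -> : rescale (E - t) g^`() = (rescale E g)^`().
    apply/polyP=> j; rewrite coef_rescale !coef_deriv coef_rescale.
    by rewrite rmorphMn mulnS subnDA mulrnAl.
  rewrite rescale_field_coef.
  have -> : (s * u.+1 + t * s = t * s.-1 + gap)%N.
    by rewrite /gap -[in (t * s)%N](prednK s_gt0) mulnS; lia.
  by rewrite exprD polyCM !mulrnAr !mulrA.
- move=> j; rewrite coefZ /field_coef coefCM coefD coefCM coefXn coefC => cj.
  rewrite leq_mul2l; apply/orP; right; apply: contraNT cj.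
  rewrite -ltnNge => lt_sj.
  by rewrite !gtn_eqF ?(leq_trans _ lt_sj) // mulr0 addr0 !mulr0.
move=> j; rewrite coef_deriv => gj.
have /leE : g`_j.+1 != 0 by apply: contraNneq gj => ->; rewrite mul0rn.
by rewrite mulnS leq_subRL.
Qed.

(** The coefficient of z^(t(s-1) + gap + v) in the rescaled equation d g = L g,
    as an equation between polynomials in Y. *)
Lemma graded_equation E (g L H K : {poly {poly k}}) v :
    (t <= E)%N -> (forall j, g`_j != 0 -> (t * j <= E)%N) ->
    (size L <= s)%N -> xder field_coef g = L * g ->
    H = swapXY (rescale E g) -> K = swapXY (rescale (t * s.-1) ('X *: L)) ->
  (K * H)`_(t * s.-1 + gap + v) *+ s =
    H`_(gap + v) *+ (gap + v) - H`_(gap + v) *+ E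
    + ('X * (H`_(gap + v))^`()) *+ t + (binom * (H`_v)^`()) *+ s.
Proof.
move=> le_tE leE leL gL HE KE; set w := (gap + v)%N.
have rescale_Lg : rescale (E + t * s.-1) ('X *: xder field_coef g) =
    rescale (t * s.-1) ('X *: L) * rescale E g.
  rewrite gL scalerAl addnC rescaleM // => j; rewrite coefZ => Lj.
  rewrite leq_mul2l; apply/orP; right; rewrite -ltnS prednK //.
  apply: leq_trans leL; rewrite ltnNge; apply: contraNN Lj => /leq_sizeP -> //.
  by rewrite mulr0.
have := congr1 (fun p => (swapXY p)`_(t * s.-1 + gap + v))
  (rescale_xder le_tE leE).
rewrite rescale_Lg rmorphMn rmorphM /= coefMn -HE -KE => ->.
rewrite rmorphM /= swapXY_polyC map_polyXn -addnA coefXnM ltnNge leq_addr /=.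
rewrite addKn -/w rmorphD rmorphMn rmorphM rmorphD rmorphB rmorphM !rmorphMn.
rewrite !rmorphM /= !swapXY_polyC map_polyX map_polyXn swapXY_X.
rewrite swapXY_map_polyC swapXY_map_deriv swapXY_deriv -HE.
rewrite !(coefD, coefB, coefN, coefMn) coefXM coefXnM.
rewrite /w ltnNge leq_addr /= addKn -/w !coefCM !coef_map /=.
congr (_ + _ + _ + _).
by case: w => [|w]; rewrite ?mulr0n // coef_deriv.
Qed.

(** * Absence of Darboux polynomials *)

Theorem no_darboux_polynomial (g L : {poly {poly k}}) :
  (0 < t)%N -> (1 < size g)%N -> xder field_coef g <> L * g.
Proof.
move=> t_gt0 g_gt1 gL; set n := (size g).-1.
have n_gt0 : (0 < n)%N by rewrite /n; case: (size g) g_gt1 => [|[]].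
have szg : size g = n.+1 by rewrite prednK // ltnW.
have g_neq0 : g != 0 by rewrite -size_poly_gt0 szg.
have leL : (size L <= s)%N.
  have [->|L_neq0] := eqVneq L 0; first by rewrite size_poly0.
  have : (size (xder field_coef g) <= n + s)%N.
    rewrite (leq_trans (size_polyD _ _)) // geq_max; apply/andP; split.
      by rewrite (leq_trans (size_poly _ _)) // szg; lia.
    have sF : (size field_coef <= s.+1)%N.
      apply/leq_sizeP=> j lt_j; rewrite coefCM coefD coefCM coefXn coefC.
      by rewrite !gtn_eqF // ?mulr0 ?addr0 ?mulr0 // (leq_trans _ lt_j).
    have sg' : (size g^`() <= n)%N by rewrite -ltnS -szg lt_size_deriv.
    apply: leq_trans (size_polyMleq _ _) _; rewrite -subn1 leq_subLR.
    by apply: leq_trans (leq_add sF sg') _; lia.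
  by rewrite gL size_mul // szg addnS /= addnC leq_add2l.
(* The summand gap ensures gap <= M below, so that h_m = H`_(M - m) is a true
   coefficient for every m <= gap. *)
pose E := (t * n + gap)%N.
have le_tE : (t <= E)%N by rewrite /E /gap; lia.
have leE j : g`_j != 0 -> (t * j <= E)%N.
  move=> gj; rewrite (@leq_trans (t * n)) ?leq_addr // leq_mul2l.
  apply/orP; right.
  by rewrite -ltnS -szg ltnNge; apply: contraNN gj => /leq_sizeP -> .
pose gh := rescale E g; pose H := swapXY gh.
pose Lh := rescale (t * s.-1) ('X *: L); pose K := swapXY Lh.
pose P := (t * s.-1 + gap)%N; pose M := (size H).-1.
have eqn v := graded_equation v le_tE leE leL gL (erefl H) (erefl K).
rewrite -/P in eqn.
have sM : (size H <= M.+1)%N by rewrite /M; case: size.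
have H0 w : (M < w)%N -> H`_w = 0.
  by move=> lt_w; rewrite nth_default // (leq_trans sM).
have gap_gt0 : (0 < gap)%N by rewrite /gap mulnS; lia.
have sn0 : s%:R != 0 :> {poly k}.
  by rewrite -polyC_natr polyC_eq0 natr_neq0.
have mulsI := @mulrn_inj {poly k} s s_gt0.
have ghn : gh`_n = (lead_coef g \Po 'X^s) * 'X^gap.
  by rewrite coef_rescale addKn.
have lg_neq0 : lead_coef g \Po 'X^s != 0.
  by rewrite comp_poly_eq0 ?lead_coef_eq0 // size_polyXn ltnS.
have ghn_neq0 : gh`_n != 0 by rewrite ghn mulf_neq0 ?expf_neq0 ?polyX_eq0.
pose wA := (size gh`_n).-1.
have wA_neq0 : H`_wA`_n != 0 by rewrite coef_swapXY lead_coef_eq0.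
have le_wAM : (wA <= M)%N.
  by rewrite leqNgt; apply: contraNN wA_neq0 => /H0 ->; rewrite coef0.
have le_gap_wA : (gap <= wA)%N.
  rewrite /wA ghn size_mulXn //; move: lg_neq0; rewrite -size_poly_gt0.
  by case: size => // m _; rewrite addnS leq_addr.
have le_gapM := leq_trans le_gap_wA le_wAM.
have H_neq0 : H != 0 by apply: contraNneq wA_neq0 => ->; rewrite !coef0.
have hM_neq0 : H`_M != 0 by rewrite lead_coef_eq0.
(* Otherwise the product of the leading coefficients of K and H would be a
   coefficient beyond the z-degree of the left-hand side. *)
have sP : (size K <= P.+1)%N.
  rewrite leqNgt; apply/negP => lt_P; pose Q := (size K).-1.
  have szK : size K = Q.+1 by rewrite prednK // (leq_trans _ lt_P).
  have lt_PQ : (P < Q)%N by rewrite -ltnS -szK.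
  have := eqn (Q + M - P)%N; rewrite !H0; [|lia|lia].
  rewrite (_ : P + _ = Q + M)%N; last by lia.
  rewrite coefM_top ?szK // !(deriv0, mulr0, mul0rn, subr0, addr0) => /eqP.
  rewrite -mulr_natr !mulf_eq0 (negPf sn0) (negPf hM_neq0) !orbF lead_coef_eq0.
  by rewrite -size_poly_eq0 szK.
have sH w : (size (H`_w)%R <= n.+1)%N.
  apply/leq_sizeP=> j lt_j; rewrite coef_swapXY coef_rescale.
  rewrite [g`_j]nth_default ?szg //.
  by rewrite comp_poly0 mul0r coef0.
pose h0 := H`_M.
have eq0 : binom * h0^`() = K`_P * h0.
  have := eqn M; rewrite coefM_top // (H0 (gap + M)%N); last by lia.
  by rewrite !(deriv0, mulr0, mul0rn, oppr0, addr0, add0r) => /mulsI->.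
have sK0 : (size (K`_P)%R <= s)%N.
  apply/leq_sizeP=> j le_j; rewrite coef_swapXY coef_rescale coefZ.
  rewrite [L`_j]nth_default.
    by rewrite mulr0 comp_poly0 mul0r coef0.
  exact: leq_trans le_j.
(* Compare the coefficients of Y^(n+s-1) at the top z-degree of the coefficient
   of Y^n in H; this is where c1 x^(u+t) y^s d/dy acts on the leading term. *)
have lcK : K`_P`_s.-1 = c1 *+ n.
  have := congr1 (fun p : {poly k} => p`_(n + s.-1)) (eqn wA).
  rewrite !(coefD, coefN, coefMn) coef_binom_deriv //.
  have top j : (n <= j)%N -> H`_(gap + wA)`_j = 0.
    rewrite leq_eqVlt => /predU1P [<-|lt_nj]; last first.
      by rewrite nth_default // (leq_trans (sH _)).
    rewrite coef_swapXY nth_default //; move: gap_gt0; rewrite /wA.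
    by case: size => [|m]; lia.
  rewrite top ?leq_addr // coefXM coef_deriv.
  rewrite (_ : (if _ then _ else _) = 0); last first.
    by case: eqP => // nz; rewrite prednK ?top ?mul0rn ?leq_addr //; lia.
  rewrite !(mul0rn, oppr0, addr0, add0r) => eqc.
  have sLh : (size Lh <= s.-1.+1)%N.
    rewrite prednK //; apply/leq_sizeP=> j le_j.
    rewrite coef_rescale coefZ [L`_j]nth_default.
      by rewrite mulr0 comp_poly0 mul0r.
    exact: leq_trans le_j.
  have sgh : (size gh <= n.+1)%N.
    by rewrite /gh (leq_trans (size_poly _ _)) ?szg.
  have sLhs : (size (Lh`_s.-1)%R <= P.+1)%N.
    apply/leq_sizeP=> j lt_j.
    rewrite -coef_swapXY -/K [K`_j]nth_default ?coef0 //.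
    exact: leq_trans lt_j.
  have KH : K * H = swapXY (Lh * gh) by rewrite rmorphM.
  move: eqc; rewrite KH !coef_swapXY [(n + _)%N]addnC coefM_top // coefM_top //.
    move=> /(@mulrn_inj k^o s s_gt0); rewrite -mulrnAl; apply: mulIf.
    by rewrite -coef_swapXY.
  by rewrite /wA; case: size.
(* The leading coefficients of f h0' = l0 h0 give deg h0 = n. *)
have sh0 : size h0 = n.+1.
  pose n' := (size h0).-1.
  have szh0 : size h0 = n'.+1 by rewrite prednK // size_poly_gt0.
  have := congr1 (fun p : {poly k} => p`_(n' + s.-1)) eq0.
  rewrite coef_binom_deriv ?szh0 // addnC coefM_top ?szh0 //; last first.
    by rewrite prednK.
  rewrite lcK mulrnAl -mulr_natr -[RHS](mulr_natr (c1 * _)) => /mulfI eqn'.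
  have /eqP : n'%:R = n%:R :> k.
    by apply: eqn'; rewrite mulf_neq0 // -[n'](congr1 predn szh0) lead_coef_eq0.
  by move/eqP/natr_inj=> ->.
have le_sh w : (size (H`_w)%R <= size h0)%N by rewrite sh0.
have h0_neq0 : h0 != 0 by [].
have Km0 m : (0 < m < gap)%N -> K`_(P - m) = 0.
  elim/ltn_ind: m => m IHm /andP[m_gt0 lt_m].
  have eqm : binom * (H`_(M - m))^`() = K`_P * H`_(M - m) + K`_(P - m) * h0.
    apply: mulsI; rewrite -(@coefM_top2 _ K H P M m) //.
    - rewrite eqn (H0 (gap + (M - m))%N); last by lia.
      by rewrite !(deriv0, mulr0, mul0rn, oppr0, addr0, add0r).
    - exact: leq_trans (ltnW lt_m) (leq_addl _ _).
    - exact: leq_trans (ltnW lt_m) le_gapM.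
    - by move=> i /andP[i0 lti]; apply: IHm => //; rewrite i0; lia.
  apply: (squarefree_wronskian_eq0 coprime_binom_deriv h0_neq0
    (le_sh (M - m)%N)).
  apply: (eq_of_multiple (c := h0) eqm).
  apply: (eq_of_multiple (c := - H`_(M - m)) eq0).
  ring.
(* The constant coefficient of h0 can only come from g`_0(z^s) z^E. *)
have le_EM : (E <= M)%N.
  have := darboux_coef0_neq0 h0_neq0 eq0.
  rewrite coef_swapXY coef_rescale muln0 subn0.
  by rewrite coefMXn; case: leqP => //; rewrite eqxx.
have eqG : (M - E)%:R *: h0 + ('X * h0^`()) *+ t
    + (binom * (H`_(M - gap))^`()) *+ s
    = (K`_P * H`_(M - gap) + K`_(P - gap) * h0) *+ s.
  rewrite -(@coefM_top2 _ K H P M gap) ?leq_addl // eqn subnKC //.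
  by rewrite scaler_nat mulrnBr.
have := subleading_relation h0_neq0 (le_sh _) eq0 eqG.
rewrite sh0 -mulrnA -natrD => rel.
have /eqP : ((M - E) * s + n * t)%:R = 0 :> k.
  (* l_G(0) = 0: the constant coefficient of x L vanishes at x = 0. *)
  apply: rel; rewrite coef_swapXY addnK coef_rescale muln0 subn0.
  rewrite coefMXn ltnn subnn -horner_coef0 horner_comp hornerXn expr0n.
  by rewrite (gtn_eqF s_gt0) coefZ hornerM hornerX mul0r.
by apply/negP; apply: natr_neq0; rewrite addn_gt0 !muln_gt0 n_gt0 t_gt0 orbT.
Qed.
End Binomial.

(** * From invariant ideals to Darboux polynomials *)

Lemma exists_irreducible_dvdp (p : {poly k}) : (1 < size p)%N ->
  exists2 q, irreducible_poly q & q %| p.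
Proof.
have [m] := ubnP (size p); elim: m p => // m IHm p lt_pm p_gt1.
have [irr_p|red_p] := classic (irreducible_poly p); first by exists p.
have [q [q_neq1 q_p not_qp]] : exists q : {poly k},
    [/\ size q != 1%N, q %| p & ~~ (q %= p)].
  apply: NNPP => no_q; apply: red_p; split=> // q q_neq1 q_p.
  by apply/negPn/negP=> not_qp; apply: no_q; exists q.
have p_neq0 : p != 0 by rewrite -size_poly_gt0 ltnW.
have q_neq0 : q != 0 by apply: contraTneq q_p => ->; rewrite dvd0p.
have lt_qp : (size q < size p)%N.
  by rewrite ltn_neqAle dvdp_leq // andbT dvdp_size_eqp.
have [||r irr_r r_q] := IHm q; first exact: leq_trans lt_qp lt_pm.
  by rewrite ltn_neqAle eq_sym q_neq1 size_poly_gt0.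
by exists r => //; apply: dvdp_trans q_p.
Qed.

Lemma coef_dvd_scale (p : {poly k}) (g : {poly {poly k}}) :
  (forall i, p %| g`_i) -> exists h, g = p *: h.
Proof.
move=> p_g; exists (\poly_(i < size g) (g`_i %/ p)).
apply/polyP=> i; rewrite coefZ coef_poly; case: ltnP => [_|le_gi].
  by rewrite mulrC divpK.
by rewrite nth_default ?mulr0.
Qed.

(** The Gauss lemma: an irreducible p stays prime in k[x][y], as the product of
    the first coefficients of g and h that p does not divide shows. *)
Lemma irreducible_dvd_coefM (p : {poly k}) (g h : {poly {poly k}}) :
    irreducible_poly p -> (forall i, p %| (g * h)`_i) ->
  (forall i, p %| g`_i) \/ (forall i, p %| h`_i).
Proof.
move=> irr_p p_gh.
have least (f : {poly {poly k}}) : ~ (forall i, p %| f`_i) ->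
    exists2 i, ~~ (p %| f`_i) & forall j, (j < i)%N -> p %| f`_j.
  move=> not_pf.
  have ex_i : exists i, ~~ (p %| f`_i).
    apply: NNPP => no_i; apply: not_pf => i; apply/negPn/negP=> npf.
    by apply: no_i; exists i.
  exists (ex_minn ex_i); case: ex_minnP => // i _ min_i j lt_ji.
  by apply/negPn/negP=> /min_i; rewrite leqNgt lt_ji.
apply: NNPP => /not_or_and [/least [i ngi lt_i] /least [j nhj lt_j]].
have := p_gh (i + j)%N; rewrite coefM.
have lt_ij : (i < (i + j).+1)%N by rewrite ltnS leq_addr.
rewrite (bigD1 (Ordinal lt_ij)) //= addKn dvdp_addl.
  by rewrite Gauss_dvdpr ?(negPf nhj) // irreducible_poly_coprime.
apply: (big_ind (fun a => p %| a)) => [|a b|l]; [exact: dvdp0|exact: dvdp_add|].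
rewrite -val_eqE /= neq_ltn => /orP[lt_li|lt_il].
  by rewrite dvdp_mulr ?lt_i.
by rewrite dvdp_mull // lt_j //; have := ltn_ord l; lia.
Qed.

Definition primitive (g : {poly {poly k}}) :=
  forall p : {poly k}, (forall i, p %| g`_i) -> size p = 1%N.

(** The irreducible factors of p divide q g but not the primitive g, so they can
    be cancelled from q one at a time. *)
Lemma primitive_cancel (g b q : {poly {poly k}}) (p : {poly k}) :
    primitive g -> p != 0 -> p *: b = q * g ->
  exists L, b = L * g.
Proof.
move=> prim_g; have [m] := ubnP (size p).
elim: m p q => // m IHm p q lt_pm p_neq0 eqb.
have [p_le1|/exists_irreducible_dvdp [r irr_r /dvdpP [p1 pE]]] :=
  leqP (size p) 1.
  have [c c_neq0 pE] : exists2 c, c != 0 & p = c%:P.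
    by apply/size_poly1P; rewrite eqn_leq p_le1 size_poly_gt0.
  exists (c^-1%:P *: q); rewrite -scalerAl -eqb pE scalerA -polyCM mulVf //.
  by rewrite scale1r.
have [|q_r|g_r] := @irreducible_dvd_coefM r q g irr_r.
- by move=> i; rewrite -eqb coefZ pE dvdp_mulr ?dvdp_mull.
- have [q1 q1E] := coef_dvd_scale q_r.
  have r_neq0 := irredp_neq0 irr_r.
  have p1_neq0 : p1 != 0.
    by move: p_neq0; rewrite pE mulf_eq0 negb_or => /andP[].
  apply: (IHm p1 q1) => //.
    rewrite -ltnS; apply: leq_trans lt_pm; rewrite pE size_mul // ltnS.
    case: irr_r; case: (size r) => [|[|n]] // _ _.
    by rewrite !addnS ltnS leq_addr.
  have rC_neq0 : r%:P != 0 :> {poly {poly k}} by rewrite polyC_eq0.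
  apply: (mulfI rC_neq0); rewrite !mul_polyC scalerA mulrC -pE eqb q1E.
  by rewrite scalerAl.
- by case: irr_r; rewrite (prim_g _ g_r).
Qed.

Section InvariantIdeal.
Variables (F : {poly {poly k}}) (I : {poly {poly k}} -> Prop).
Hypothesis diffI : differential_ideal (xder F) I.

Let ID a b : I a -> I b -> I (a + b).
Proof. by case: diffI => [[]] /=; auto. Qed.
Let IM a b : I b -> I (a * b).
Proof. by case: diffI => [[]] /=; auto. Qed.
Let Id a : I a -> I (xder F a).
Proof. by case: diffI => /=; auto. Qed.
Let IZ (p : {poly k}) a : I a -> I (p *: a).
Proof. by rewrite -mul_polyC; apply: IM. Qed.
Let IB a b : I a -> I b -> I (a - b).
Proof.
by move=> Ia Ib; rewrite -[b]mul1r -mulNr; apply: ID => //; apply: IM.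
Qed.

Lemma invariant_ideal_polyC (p : {poly k}) : p != 0 -> I p%:P -> I 1.
Proof.
have [m] := ubnP (size p); elim: m p => // m IHm p lt_pm p_neq0 Ip.
have [p_le1|p_gt1] := leqP (size p) 1.
  have [c c_neq0 pE] : exists2 c, c != 0 & p = c%:P.
    by apply/size_poly1P; rewrite eqn_leq p_le1 size_poly_gt0.
  have -> : 1 = c^-1%:P%:P * p%:P by rewrite pE -!polyCM mulVf.
  exact: IM.
apply: (IHm p^`()); last by rewrite -(xderC F); apply: Id.
  by apply: leq_trans (lt_size_deriv p_neq0) lt_pm.
by apply: contraTneq p_gt1 => /size_deriv0; rewrite -leqNgt.
Qed.

(** The set J of the proof is the saturation of I by the nonzero polynomials in
    x.  Minimality of the y-degree makes remainders by g vanish; minimality of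
    the degree of the leading coefficient makes g primitive. *)
Lemma invariant_ideal_darboux (a : {poly {poly k}}) : a != 0 -> I a ->
  I 1 \/ exists g L : {poly {poly k}}, (1 < size g)%N /\ xder F g = L * g.
Proof.
move=> a_neq0 Ia.
pose J (g : {poly {poly k}}) := exists2 p : {poly k}, p != 0 & I (p *: g).
have [n [g0 [g0_neq0 Jg0 szg0]] min_n] :
    exists2 n, exists g, [/\ g != 0, J g & size g = n] &
      forall m, (exists g, [/\ g != 0, J g & size g = m]) -> (n <= m)%N.
  apply: ex_least; exists (size a), a; split=> //.
  by exists 1; rewrite ?oner_eq0 // scale1r.
have [m [g [Jg szg szlg]] min_m] :
    exists2 m, exists g, [/\ J g, size g = n & size (lead_coef g) = m] &
      forall m', (exists g, [/\ J g, size g = n &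
        size (lead_coef g) = m']) -> (m <= m')%N.
  by apply: ex_least; exists (size (lead_coef g0)), g0.
have g_neq0 : g != 0 by rewrite -size_poly_eq0 szg -szg0 size_poly_eq0.
have [p p_neq0 Ipg] := Jg.
have [g_le1|g_gt1] := leqP (size g) 1; [left|right].
  have gE := size1_polyC g_le1.
  apply: (@invariant_ideal_polyC (p * g`_0)).
    by rewrite mulf_neq0 // -polyC_eq0 -gE.
  by rewrite polyCM -gE mul_polyC.
have prim_g : primitive g.
  move=> r r_g; have [h gE] := coef_dvd_scale r_g.
  have [r_neq0 h_neq0] : r != 0 /\ h != 0.
    by move: g_neq0; rewrite gE -mul_polyC mulf_eq0 polyC_eq0 negb_or => /andP.
  have Jh : J h by exists (p * r); rewrite ?mulf_neq0 // -scalerA -gE.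
  have := min_m (size (lead_coef h)) _; rewrite -szlg gE lead_coefZ.
  rewrite size_mul ?lead_coef_eq0 // => le_h.
  have /le_h : exists g1, [/\ J g1, size g1 = n &
      size (lead_coef g1) = size (lead_coef h)].
    by exists h; split=> //; rewrite -szg gE size_scale.
  have : (0 < size (lead_coef h))%N by rewrite size_poly_gt0 lead_coef_eq0.
  have : (0 < size r)%N by rewrite size_poly_gt0.
  case: (size r) => [//|[//|r1]] _; case: size => // h1 _.
  by rewrite !addnS !addSn /= ltnS ltnNge leq_addl.
have Ipdg : I (p ^+ 2 *: xder F g).
  have -> : p ^+ 2 *: xder F g = p *: xder F (p *: g) - p^`() *: (p *: g).
    rewrite xderZ (scalerDr p) !scalerA [p * p^`()]mulrC.
    by rewrite addrAC subrr add0r expr2.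
  by apply: IB; apply: IZ => //; apply: Id.
have divE := Pdiv.Idomain.divp_eq (xder F g) g.
set e := lead_coef g ^+ _ in divE; set q := Pdiv.Idomain.divp _ _ in divE.
set r := Pdiv.Idomain.modp _ _ in divE.
have r0 : r = 0.
  apply/eqP/negPn/negP=> r_neq0.
  have : (n <= size r)%N.
    apply: min_n; exists r; split=> //.
    exists (p ^+ 2); first by rewrite expf_neq0.
    have -> : r = e *: xder F g - q * g by rewrite divE addrC addKr.
    rewrite scalerBr scalerA mulrC -scalerA scalerAr expr2.
    rewrite -(scalerA p p g) -scalerAr.
    by apply: IB; [apply: IZ|apply: IZ; apply: IM].
  by rewrite leqNgt -szg Pdiv.Idomain.ltn_modpN0.
have [||L LE] := @primitive_cancel g (xder F g) q e prim_g.
- by rewrite expf_neq0 // lead_coef_eq0.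
- by rewrite divE r0 addr0.
by exists g, L.
Qed.

End InvariantIdeal.

(** * Transport to polynomials in two variables *)

Section Evaluation.
Variables (A : comAlgType k) (x y : A).

Definition eval2 : {poly {poly k}} -> A :=
  horner_morph (fun p : {poly k} => mulrC y (horner_alg x p)).

HB.instance Definition _ := GRing.RMorphism.on eval2.

Lemma eval2_xder (d : A -> A) F : kderivation d -> d x = 1 -> d y = eval2 F ->
  forall g, d (eval2 g) = eval2 (xder F g).
Proof.
move=> [[dD dM] dZ] dx dy.
have d1 : d 1 = 0.
  have := dM 1 1; rewrite !mul1r => /esym/eqP.
  by rewrite -subr_eq0 addrK => /eqP.
have d0 : d 0 = 0 by rewrite -(scale0r (1 : A)) dZ !scale0r.
have dp (p : {poly k}) : d (horner_alg x p) = horner_alg x p^`().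
  elim/poly_ind: p => [|p c IHp]; first by rewrite deriv0 !rmorph0.
  rewrite derivD derivM derivX derivC mulr1 addr0 !rmorphD !rmorphM /=.
  rewrite horner_algX horner_algC dD dM dx IHp dZ d1 scaler0 mulr1 addr0.
  by rewrite mulrC addrC.
elim/poly_ind=> [|g p IHg].
  by rewrite /xder rmorph0 deriv0 map_poly0 mulr0 addr0 rmorph0.
have -> : xder F (g * 'X + p%:P) = xder F g * 'X + g * F + p^`()%:P.
  rewrite /xder derivD derivM derivX derivC raddfD /= map_polyC /=.
  suff -> : map_poly (@deriv k) (g * 'X) = map_poly (@deriv k) g * 'X by ring.
  by apply/polyP=> -[|i]; rewrite !(coef_map, coefMX) /= ?deriv0.
rewrite !rmorphD !rmorphM /= dD dM IHg.
rewrite /eval2 !horner_morphX !horner_morphC dp -/eval2 dy.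
by rewrite [y * _]mulrC [X in X + _ = _]addrC.
Qed.

End Evaluation.
End Univariate.

(** By surjectivity an ideal is determined by its inverse image under
    evaluation. *)
Lemma eval2_surj (k : fieldType) (a : {mpoly k[2]}) :
  exists g, eval2 (xvar k) (yvar k) g = a.
Proof.
pose im (b : {mpoly k[2]}) := exists g, eval2 (xvar k) (yvar k) g = b.
have imM b c : im b -> im c -> im (b * c).
  by move=> [g <-] [h <-]; exists (g * h); rewrite rmorphM.
have imX i : im 'X_i.
  have [->|->] : i = ord0 \/ i = ord_max.
    by case: i => [[|[|//]] lt_i]; [left|right]; apply: val_inj.
  - by exists ('X%:P); rewrite /eval2 horner_morphC /= horner_algX.
  - by exists 'X; rewrite /eval2 horner_morphX.
have imC c : im c%:A.
  by exists c%:P%:P; rewrite /eval2 horner_morphC /= horner_algC.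
elim/mpolyind: a => [|c m p _ _ [g gE]]; first by exists 0; rewrite rmorph0.
have [h hE] : im (c *: 'X_[m]).
  rewrite -[_ *: _]mul1r -scalerAr scalerAl; apply: (imM); first exact: imC.
  rewrite mpolyXE_id; apply: (big_ind im) => [||i _]; [|exact: imM|].
    by exists 1; rewrite rmorph1.
  elim: (m i) => [|e IHe]; first by exists 1; rewrite rmorph1.
  by rewrite exprS; apply: imM.
by exists (h + g); rewrite rmorphD /= gE hE.
Qed.

Theorem theorem3p4 (k : fieldType) (char0 : [pchar k] =i pred0)
    (s t u : nat) (hs : (1 <= s)%N) (ht : (1 <= t)%N)
    (c1 c2 : k) (hc1 : c1 != 0) (hc2 : c2 != 0) :
  simple_derivation
    (derxy 1 (xvar k ^+ u * (c1 *: (xvar k ^+ t * yvar k ^+ s) + c2%:MP))).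
Proof.
set Q := _ * _; have kder := derxy_kderivation 1 Q.
split=> [|I [[I0 ID IM] Id]]; first exact: kder.1.
pose ev := eval2 (xvar k) (yvar k); pose F := field_coef s t c1 c2 u.
have evF : derxy 1 Q (yvar k) = ev F.
  rewrite derxy_y /ev /F /field_coef !(rmorphD, rmorphM, rmorphXn) /=.
  rewrite /eval2 !horner_morphC horner_morphX /=.
  rewrite linearZ /= rmorphXn /= !horner_algX horner_algC -!scalerAl mul1r.
  by rewrite -[c2%:A]mul_mpolyC mulr1.
have evD := eval2_xder kder (derxy_x _ _) evF.
have diffJ : differential_ideal (xder F) (fun g => I (ev g)).
  rewrite /ev; split; first split=> [|g h|g h].
  - by rewrite rmorph0.
  - by rewrite rmorphD; apply: ID.
  - by rewrite rmorphM; apply: IM.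
  by move=> g Ig; rewrite -[eval2 _ _ _]evD; apply: Id.
have [[a [Ia a_neq0]]|I_0] := classic (exists a, I a /\ a != 0); [right|left].
  have [g gE] := eval2_surj a.
  have g_neq0 : g != 0.
    by apply: contraNneq a_neq0 => g0; rewrite -gE g0 rmorph0.
  suff I1 : I 1 by move=> b; rewrite -[b]mulr1; apply: IM.
  have [|I1|[h [L [h_gt1 hL]]]] := invariant_ideal_darboux char0 diffJ g_neq0.
  - by rewrite /ev gE.
  - by rewrite /ev rmorph1 in I1.
  - by have := no_darboux_polynomial char0 hs hc1 hc2 ht h_gt1 hL.
move=> a; split=> [Ia|-> //]; apply/eqP/negPn/negP=> a_neq0.
by apply: I_0; exists a.
Qed.
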